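(* Let $\mathbb{F}$ be a finite field, let $2\le k<n$, let $\alpha_1,\dots,\alpha_n\in\mathbb{F}$ be distinct, let $v=(v_1,\dots,v_n)\in\mathbb{F}^n$, and let $m\ge 1$. Let $N=n\binom{m+1}{2}+1$ and let $l$ be the largest integer strictly less than $\sqrt{\frac{2N}{k-1}+\frac14}-\frac12$. Then Algorithm I (described in the context), run on $v$ with parameters $m$ and $l$, terminates, outputs the minimal polynomial of $I_{v,m,l}$ with respect to $>_{k-1}$ (up to a nonzero scalar), and uses $O(n^4k^{-2}m^5)$ multiplication operations in $\mathbb{F}$, with an absolute implied constant.
   Context: Notation. $\deg_u(x^iy^j)=i+uj$, and $\deg_u(f)$ is the maximum of $\deg_u$ over the monomials occurring in $f$. The order $>_u$ on monomials is: $x^iy^j>_u x^{i'}y^{j'}$ iff $\deg_u(x^iy^j)>\deg_u(x^{i'}y^{j'})$, or these weighted degrees are equal and $j>j'$. $\mathrm{lt}(g)$ is the leading term of a nonzero $g$ with respect to $>_{k-1}$; $\deg$ and $\mathrm{lc}$ are the degree and leading coefficient in $\mathbb{F}[x]$; $y\text{-}\deg$ is the degree in $y$. $\mathbb{F}[x,y]_l=\{f\in\mathbb{F}[x,y]: y\text{-}\deg(f)\le l\}$ is a free $\mathbb{F}[x]$-module with basis $1,y,\dots,y^l$. The multiplicity $\mathrm{mult}_P(f)$ of a nonzero $f\in\mathbb{F}[x,y]$ at $P=(a,b)$ is the smallest total degree of a monomial occurring in $f(x+a,y+b)$. With $P_i=(\alpha_i,v_i)$, $I_{v,m}=\{f\in\mathbb{F}[x,y]:\mathrm{mult}_{P_i}(f)\ge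 m \text{ for } 1\le i\le n\}\cup\{0\}$ and $I_{v,m,l}=I_{v,m}\cap\mathbb{F}[x,y]_l$, an $\mathbb{F}[x]$-submodule of $\mathbb{F}[x,y]_l$. The minimal polynomial of a nonzero submodule (with respect to a monomial order) is a nonzero element whose leading monomial is smallest; it is unique up to a nonzero scalar. Let $\tilde h_i=\prod_{j\ne i}(x-\alpha_j)$, $h_i=\tilde h_i(\alpha_i)^{-1}\tilde h_i$, and $h_v=\sum_{i=1}^n v_ih_i$ (so $\deg h_v<n$ and $h_v(\alpha_i)=v_i$). Algorithm I. Write $g_i=\sum_{j=0}^l a_{ij}y^j$ with $a_{ij}\in\mathbb{F}[x]$ for the current value of $g_i$ throughout the execution. I1. Compute $h_v$. I2. For $0\le i\le m$ set $g_i\leftarrow (y-h_v)^i\prod_{j=1}^n(x-\alpha_j)^{m-i}$; for $m<i\le l$ set $g_i\leftarrow y^{i-m}(y-h_v)^m$. Set $r\leftarrow 0$. I3. Increase $r$ by $1$. If $r\le l$ proceed; otherwise go to I7. I4. Let $s=y\text{-}\deg(\mathrm{lt}(g_r))$. If $s=r$, go to I3. I5. Set $d\leftarrow\deg(a_{rs})-\deg(a_{ss})$ and $c\leftarrow\mathrm{lc}(a_{rs})\,\mathrm{lc}(a_{ss})^{-1}$. I6. If $d\ge 0$, set $g_r\leftarrow g_r-cx^dg_s$. If $d<0$, simultaneously replace $(g_s,g_r)$ by $(g_r,\;x^{-d}g_r-cg_s)$ (old values on the right). Go to I4. I7. Output the $g_i$ with the smallest leading term, and stop. Cost model: the count is the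 number of multiplications in $\mathbb{F}$; polynomial multiplication is done by the straightforward method, so the product of polynomials in $\mathbb{F}[x]$ of degrees $a$ and $b$ costs $(a+1)(b+1)$ multiplications; multiplication by a power of $x$ is free; the polynomials $h_i$ and powers of $\prod_{j=1}^n(x-\alpha_j)$ are regarded as precomputed. *)

(* Defs.v *)
From mathcomp Require Import all_boot all_order all_algebra.
From mathcomp Require Export reals.

Set Implicit Arguments.
Unset Strict Implicit.
Unset Printing Implicit Defensive.

Import Order.TTheory GRing.Theory Num.Theory.
Local Open Scope ring_scope.

(* F[x,y] is {poly {poly F}} = F[x][y]: y is 'X, x is 'X%:P, and the
   coefficient of x^i y^j in f is f`_j`_i. The monomial x^i y^j is encoded by
   its exponent pair (i, j). *)

Definition mon_deg (u : nat) (t : nat * nat) : nat := (t.1 + u * t.2)%N.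

Definition mon_lt (u : nat) (t t' : nat * nat) : bool :=
  (mon_deg u t < mon_deg u t')%N ||
  ((mon_deg u t == mon_deg u t') && (t.2 < t'.2)%N).

Definition mon_le (u : nat) (t t' : nat * nat) : bool :=
  (t == t') || mon_lt u t t'.

Definition mon_max (u : nat) (t t' : nat * nat) : nat * nat :=
  if mon_lt u t t' then t' else t.

Section Bivariate.

Variable F : fieldType.
Implicit Types (p q : {poly F}) (f g : {poly {poly F}}).

Definition supp f : seq (nat * nat) :=
  [seq t <- [seq (i, j) | j <- iota 0 (size f), i <- iota 0 (size f`_j)]
  | f`_t.2`_t.1 != 0].

(* Exponents of lt(f) for f != 0. The default (0, 0) of the maximum is the
   least monomial; it is the value at f = 0. *)
Definition lmon (u : nat) f : nat * nat :=
  \big[mon_max u/(0%N, 0%N)]_(t <- supp f) t.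

(* f(x + a, y + b) *)
Definition translate (a b : F) f : {poly {poly F}} :=
  map_poly (fun p => p \Po ('X + a%:P)) f \Po ('X + (b%:P)%:P).

(* Only meaningful for f != 0. *)
Definition mult (a b : F) f : nat :=
  let ds := [seq (t.1 + t.2)%N | t <- supp (translate a b f)] in
  \big[minn/head 0%N ds]_(d <- ds) d.

Definition in_I (n : nat) (alpha : 'I_n -> F) (v : 'rV[F]_n) (m : nat) f :
    Prop :=
  f = 0 \/ forall i : 'I_n, (m <= mult (alpha i) (v 0%R i) f)%N.

(* size f <= l.+1 says that f has y-degree at most l. *)
Definition in_Il (n : nat) (alpha : 'I_n -> F) (v : 'rV[F]_n) (m l : nat) f :
    Prop :=
  in_I alpha v m f /\ (size f <= l.+1)%N.

Definition minimal_polynomial (u : nat) (M : {poly {poly F}} -> Prop) f :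
    Prop :=
  [/\ M f, f != 0 & forall g, M g -> g != 0 -> mon_le u (lmon u f) (lmon u g)].

Definition deg p : nat := (size p).-1.

(* (deg p + 1) * (deg q + 1) multiplications in F, and none if a factor
   is 0. *)
Definition mul_cost p q : nat := (size p * size q)%N.

(* Product of p in F[x] and f in F[x,y], coefficient by coefficient. *)
Definition scale_cost p f : nat := (\sum_(j < size f) mul_cost p f`_j)%N.

Section Algorithm.

Variables (n k m l : nat) (alpha : 'I_n -> F) (v : 'rV[F]_n).

Definition htilde (i : 'I_n) : {poly F} :=
  \prod_(j < n | j != i) ('X - (alpha j)%:P).

Definition hpoly (i : 'I_n) : {poly F} :=
  (htilde i).[alpha i]^-1 *: htilde i.

Definition hvec : {poly F} := \sum_(i < n) v 0 i *: hpoly i.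

Definition eta : {poly F} := \prod_(j < n) ('X - (alpha j)%:P).

Definition I1_cost : nat := (\sum_(i < n) mul_cost ((v 0 i)%:P)%R (hpoly i))%N.

Definition I2_gen (h : {poly F}) (i : nat) : {poly {poly F}} :=
  if (i <= m)%N then (eta ^+ (m - i)) *: ('X - h%:P) ^+ i
  else 'X^(i - m) * ('X - h%:P) ^+ m.

(* (y - h)^(i+1) is obtained from (y - h)^i as y (y - h)^i - h (y - h)^i, and
   (y - h)^i is then multiplied by the precomputed power eta^(m-i).
   Multiplication by a power of y only shifts coefficients. *)
Definition I2_cost (h : {poly F}) : nat :=
  (\sum_(i < m) scale_cost h (('X - h%:P) ^+ i)%R
   + \sum_(i < m.+1) scale_cost (eta ^+ (m - i))%R (('X - h%:P) ^+ i)%R)%N.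

Inductive label := I1 | I2 | I3 | I4 | I5 | I6 | I7 | Stop.

(* The next instruction to execute, the variables of the program, and the
   number of multiplications in F made so far. Only g_0, ..., g_l are used. *)
Record state := State {
  st_label : label;
  st_h : {poly F};
  st_g : nat -> {poly {poly F}};
  st_r : nat;
  st_s : nat;
  st_d : int;
  st_c : F;
  st_out : {poly {poly F}};
  st_count : nat
}.

Definition init : state := State I1 0 (fun=> 0) 0 0 0 0 0 0.

Definition step (st : state) : state :=
  let: State lab h g r s d c out cnt := st in
  match lab with
  | I1 => State I2 hvec g r s d c out (cnt + I1_cost)
  | I2 => State I3 h (I2_gen h) 0 s d c out (cnt + I2_cost h)
  | I3 => State (if (r.+1 <= l)%N then I4 else I7) h g r.+1 s d c out cnt
  | I4 => let s' := (lmon k.-1 (g r)).2 in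
          State (if s' == r then I3 else I5) h g r s' d c out cnt
  | I5 => let ars := (g r)`_s in
          let ass := (g s)`_s in
          State I6 h g r s ((deg ars)%:Z - (deg ass)%:Z)
            (lead_coef ars * (lead_coef ass)^-1) out (cnt + 1)
  | I6 => let g' :=
            if 0 <= d then [eta g with r |-> g r - (c *: 'X^`|d|) *: g s]
            else [eta g with s |-> g r,
                             r |-> 'X^`|d| *: g r - c%:P *: g s] in
          State I4 h g' r s d c out (cnt + scale_cost c%:P (g s))
  (* some i <= l for which lt(g_i) is smallest *)
  | I7 => let i :=
            extremum (mon_le k.-1) (ord0 : 'I_l.+1) xpredT
              (fun i : 'I_l.+1 => lmon k.-1 (g i)) in
          State Stop h g r s d c (g i) cnt
  | Stop => st
  end.

Definition halts_in (st : state) : Prop :=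
  st_label st = Stop /\ exists t : nat, iter t step init = st.

End Algorithm.

End Bivariate.

Definition largest_int_below (R : realType) (B : R) (z : int) : Prop :=
  z%:~R < B /\ forall z' : int, z'%:~R < B -> z' <= z.

(* Main.v *)
Require Import Defs.
From mathcomp Require Import all_boot all_order all_algebra reals.
From mathcomp Require Import zify ring.

Set Implicit Arguments.
Unset Strict Implicit.
Unset Printing Implicit Defensive.

Import Order.TTheory GRing.Theory Num.Theory.
Local Open Scope ring_scope.

(* Correctness. Put h = h_v and eta = prod_j (x - alpha_j). Since x - alpha_i
   divides h - v_i, having multiplicity at least m at every P_i means that, for
   all j, eta^(m-j) divides the coefficient of (y - h)^j in the expansion of f
   in powers of y - h. Hence the initial g_i form an F[x]-basis of I_{v,m,l}.
   I6 is an invertible operation on bases. When the leading monomials of a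
   basis have distinct y-degrees no cancellation of leading terms occurs in a
   combination, so the least of them is the least of the whole module.

   Cost. Enumerate monomials of y-degree at most l by the order-preserving rank
   deg_{k-1} * (l+1) + y-degree. I6 strictly decreases the sum of the ranks of
   the leading monomials and never increases the largest weighted degree, which
   is at most 2nm at the start because (k-1) l <= nm. So I6 is executed
   O(l^2 nm) times at a cost of O(l nm) each; together with k l^2 = O(n m^2) and
   m <= l this gives O(l^3 n^2 m^2) = O(n^4 k^-2 m^5). *)

(** * Monomials *)

Section MonomialOrder.

Variable u : nat.
Implicit Types t : nat * nat.

(** Weighted degree and y-exponent determine a monomial, so equality is absorbed into a weak
    comparison of y-exponents. In this form the order axioms become linear arithmetic. *)
Lemma mon_leE t t' :
  mon_le u t t' = (mon_deg u t < mon_deg u t')%N ||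
                  ((mon_deg u t == mon_deg u t') && (t.2 <= t'.2)%N).
Proof.
rewrite /mon_le /mon_lt; case: eqP => [->|ne]; first by rewrite eqxx leqnn orbT.
rewrite (leq_eqVlt t.2); case: (t.2 =P t'.2) => //= e2; case: eqP => //= ed.
case: ne; case: t t' e2 ed => [i j] [i' j'] /= ->.
rewrite /mon_deg /= => ed; congr pair; lia.
Qed.

Lemma mon_le_refl : reflexive (mon_le u).
Proof. by move=> t; rewrite /mon_le eqxx. Qed.

Lemma mon_le_trans : transitive (mon_le u).
Proof. by move=> t1 t0 t2; rewrite !mon_leE; lia. Qed.

Lemma mon_le_total : total (mon_le u).
Proof. by move=> t1 t2; rewrite !mon_leE; lia. Qed.

Lemma mon_ltNge t t' : mon_lt u t t' = ~~ mon_le u t' t.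
Proof. by rewrite mon_leE /mon_lt; lia. Qed.

Lemma mon_lt_neqAle t t' : mon_lt u t t' = (t != t') && mon_le u t t'.
Proof.
rewrite /mon_le; case: eqP => //= ->.
by rewrite /mon_lt; lia.
Qed.

Lemma mon_le_anti t t' : mon_le u t t' -> mon_le u t' t -> t = t'.
Proof. by case/orP => [/eqP //|]; rewrite mon_ltNge => /negP. Qed.

Lemma mon_le_shift e t t' :
  mon_le u t t' -> mon_le u (t.1 + e, t.2)%N (t'.1 + e, t'.2)%N.
Proof. by rewrite !mon_leE /mon_deg /=; lia. Qed.

Lemma mon_le_addl e t : mon_le u t (t.1 + e, t.2)%N.
Proof. by rewrite mon_leE /mon_deg /=; lia. Qed.

Lemma mon_max_le t1 t2 t : mon_le u t t1 || mon_le u t t2 ->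
  mon_le u t (mon_max u t1 t2).
Proof. by rewrite /mon_max; case: ifP; rewrite !mon_leE /mon_lt; lia. Qed.

Definition mon_rank (l : nat) t := (mon_deg u t * l.+1 + t.2)%N.

(** An increase of the weighted degree adds at least [l.+1], which outweighs the y-exponent of the
    smaller monomial. *)
Lemma mon_rank_lt l t t' : (t.2 <= l)%N -> mon_lt u t t' ->
  (mon_rank l t < mon_rank l t')%N.
Proof.
rewrite /mon_rank /mon_lt => tl /orP[lt|/andP[/eqP -> lt]]; last by lia.
have := leq_mul2r l.+1 (mon_deg u t).+1 (mon_deg u t'); rewrite lt orbT; lia.
Qed.

Lemma mon_rank_bound l w t : (t.2 <= l)%N -> (mon_deg u t <= w)%N ->
  (mon_rank l t <= w.+1 * l.+1)%N.
Proof.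
rewrite /mon_rank => tl tw.
have := leq_mul2r l.+1 (mon_deg u t) w; rewrite tw orbT; lia.
Qed.

End MonomialOrder.

(** * Leading monomials under scaling and subtraction *)

Section LeadingMonomial.

Variables (F : fieldType) (u : nat).
Implicit Types (p q : {poly F}) (f g : {poly {poly F}}).

Lemma mem_supp f t : (t \in supp f) = (f`_t.2`_t.1 != 0).
Proof.
rewrite mem_filter; case: eqP => //= /eqP nz.
apply/allpairsPdep; exists t.2, t.1; split; last by case: t {nz}.
- rewrite mem_iota /= add0n ltnNge; apply: contra nz => /(nth_default 0) ->.
  by rewrite coef0.
- by rewrite mem_iota /= add0n ltnNge; apply: contra nz => /(nth_default 0) ->.
Qed.

Lemma size_deg p : p != 0 -> size p = (deg p).+1.
Proof. by rewrite /deg -size_poly_gt0; case: (size p). Qed.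

Lemma coef_deg p : p`_(deg p) = lead_coef p.
Proof. by []. Qed.

Lemma degM p q : p != 0 -> q != 0 -> deg (p * q) = (deg p + deg q)%N.
Proof.
by move=> p0 q0; rewrite /deg size_mul // (size_deg p0) (size_deg q0) addSn /= addnS.
Qed.

Lemma supp_neq0 f : f != 0 -> exists t, t \in supp f.
Proof.
rewrite -lead_coef_eq0 => f0; exists (deg (lead_coef f), (size f).-1).
by rewrite mem_supp /= -[f`__]/(lead_coef f) coef_deg lead_coef_eq0.
Qed.

Lemma lmon_max f t : t \in supp f -> mon_le u t (lmon u f).
Proof.
rewrite /lmon; elim: (supp f) => // a s IH; rewrite inE big_cons => /orP[/eqP ->|/IH h].
  by rewrite mon_max_le ?mon_le_refl.
by rewrite mon_max_le ?h ?orbT.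
Qed.

Lemma lmon_supp f : f != 0 -> lmon u f \in supp f.
Proof.
move=> /supp_neq0[t0 t0f]; have := lmon_max t0f.
(* The maximum is attained in the support or is the default [(0, 0)]. Being the least monomial, the
   default then coincides with [t0]. *)
have [-> //|-> le0] : lmon u f \in supp f \/ lmon u f = (0, 0)%N.
  rewrite /lmon; elim: (supp f) => [|a s IH]; first by rewrite big_nil; right.
  rewrite big_cons /mon_max; case: ifP => _; last by left; rewrite inE eqxx.
  by case: IH => [h|->]; [left; rewrite inE h orbT | right].
suff <- : t0 = (0, 0)%N by [].
by apply: mon_le_anti le0 _; rewrite mon_leE /mon_deg /=; lia.
Qed.

(** For a fixed power of y the order compares x-exponents. This links the leading term to the
    degrees and leading coefficients used in I5. *)
Lemma lmon_coef f : f != 0 ->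
  f`_(lmon u f).2 != 0 /\ deg f`_(lmon u f).2 = (lmon u f).1.
Proof.
move=> f0; have := lmon_supp f0; rewrite mem_supp; set t := lmon u f => ft.
have fj0 : f`_t.2 != 0 by apply: contraNneq ft => ->; rewrite coef0.
split=> //; apply/eqP; rewrite eqn_leq; apply/andP; split; last first.
  by rewrite -ltnS -(size_deg fj0) ltnNge; apply: contra ft => /(nth_default 0) ->.
have : (deg f`_t.2, t.2) \in supp f by rewrite mem_supp /= coef_deg lead_coef_eq0.
by move=> /lmon_max; rewrite -/t mon_leE /mon_deg /=; lia.
Qed.

Lemma lmon_max_coef f j : f`_j != 0 -> mon_le u (deg f`_j, j) (lmon u f).
Proof. by move=> nz; apply: lmon_max; rewrite mem_supp /= coef_deg lead_coef_eq0. Qed.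

Lemma lmon_unique f t : t \in supp f ->
  (forall t', t' \in supp f -> mon_le u t' t) -> lmon u f = t.
Proof.
move=> tf tmax; apply: (@mon_le_anti u); last exact: lmon_max.
apply: tmax; apply: lmon_supp; apply: contraTneq tf => ->.
by rewrite mem_supp !coef0 eqxx.
Qed.

Lemma supp_deg_le f t : t \in supp f ->
  f`_t.2 != 0 /\ mon_le u t (deg f`_t.2, t.2).
Proof.
rewrite mem_supp => ft.
have fj0 : f`_t.2 != 0 by apply: contraNneq ft => ->; rewrite coef0.
split=> //; rewrite mon_leE /mon_deg /=.
rewrite leqnn andbT orbC -leq_eqVlt leq_add2r.
by rewrite -ltnS -(size_deg fj0) ltnNge; apply: contra ft => /(nth_default 0) ->.
Qed.

Lemma lmon_scale p f : p != 0 -> f != 0 ->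
  lmon u (p *: f) = ((lmon u f).1 + deg p, (lmon u f).2)%N.
Proof.
move=> p0 f0; have [fj0 dj] := lmon_coef f0.
apply: lmon_unique => [|t' /supp_deg_le [nz le]].
  by rewrite mem_supp /= coefZ -dj addnC -degM // coef_deg lead_coef_eq0 mulf_neq0.
apply: mon_le_trans le _; rewrite coefZ in nz *.
have fj'0 : f`_t'.2 != 0 by apply: contraNneq nz => ->; rewrite mulr0.
rewrite degM // addnC; exact: (mon_le_shift (deg p) (lmon_max_coef fj'0)).
Qed.

Lemma supp_sub f g t : t \in supp (f - g) -> t \in supp f \/ t \in supp g.
Proof.
rewrite !mem_supp !coefB; case: (f`_t.2`_t.1 =P 0) => [->|]; last by left.
by rewrite sub0r oppr_eq0; right.
Qed.

(** The common leading term cancels, and every surviving monomial comes from [f] or [g]. This is the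
    effect of I6 on leading monomials. *)
Lemma lmon_sub_lt f g t : f - g != 0 -> lmon u f = t -> lmon u g = t ->
  f`_t.2`_t.1 = g`_t.2`_t.1 -> mon_lt u (lmon u (f - g)) t.
Proof.
move=> nz lf lg e; have inS := lmon_supp nz.
rewrite mon_lt_neqAle; apply/andP; split.
  by apply: contraTneq inS => ->; rewrite mem_supp !coefB e subrr eqxx.
by case/supp_sub: inS => /lmon_max; rewrite ?lf ?lg.
Qed.

Lemma lmon_size f l : (size f <= l.+1)%N -> ((lmon u f).2 <= l)%N.
Proof.
case: (eqVneq f 0) => [->|/lmon_supp]; first by rewrite /lmon /supp size_poly0 big_nil.
rewrite mem_supp => nz sz; rewrite -ltnS; apply: leq_trans sz; rewrite ltnNge.
by apply: contra nz => /(nth_default 0) ->; rewrite coef0.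
Qed.

End LeadingMonomial.

(** * Multiplicity conditions *)

Section Vanishing.

Variable F : fieldType.
Implicit Types (p q h e : {poly F}) (f g : {poly {poly F}}).

(** The coefficients are those of the expansion of [f] in powers of [y - h]. Truncated subtraction
    leaves no condition for [j >= m]. The choice [p = x - a], [h = b] expresses multiplicity at
    least [m] at [(a, b)]. *)
Definition vanishes p h m f :=
  forall j, p ^+ (m - j) %| (f \Po ('X + h%:P))`_j.

Lemma comp_XaddC f h e :
  (f \Po ('X + h%:P)) \Po ('X + e%:P) = f \Po ('X + (h + e)%:P).
Proof.
by rewrite -comp_polyA comp_polyD comp_polyX comp_polyC polyCD addrAC addrA.
Qed.

Lemma comp_XaddCK f h : (f \Po ('X + h%:P)) \Po ('X - h%:P) = f.
Proof. by rewrite -polyCN comp_XaddC subrr addr0 comp_polyXr. Qed.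

Lemma comp_XsubC_Xadd (h : {poly F}) : ('X - h%:P) \Po ('X + h%:P) = 'X.
Proof. by rewrite comp_polyB comp_polyX comp_polyC addrK. Qed.

(** For [i <= j] the coefficient is a multiple of [e ^+ (j - i)]; for [i > j] the truncated exponent
    is 0. *)
Lemma dvdp_coef_exp_XaddC p e j i :
  p %| e -> p ^+ (j - i) %| (('X + e%:P) ^+ j)`_i.
Proof.
move=> pe; elim: j i => [|j IH] i; first by rewrite sub0n expr0 dvd1p.
rewrite exprS mulrDl coefD coefXM coefCM dvdp_add //.
  by case: i => [|i] /=; rewrite ?dvdp0 // subSS.
case: (leqP i j) => ij; last first.
  by rewrite (_ : (j.+1 - i = 0)%N) ?expr0 ?dvd1p //; lia.
by rewrite subSn // exprS dvdp_mul.
Qed.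

(** The old j-th coefficient enters the new i-th one through a term divisible by
    [p ^+ (m - j) * p ^+ (j - i)], of exponent at least [m - i]. So the centre of the expansion
    matters only modulo [p]. *)
Lemma vanishes_shift p h e m f :
  p %| e -> vanishes p h m f -> vanishes p (h + e) m f.
Proof.
move=> pe vf i; rewrite -comp_XaddC; set g := f \Po _ in vf *.
rewrite comp_polyE coef_sum; elim/big_ind: _ => [|x y|j _].
- exact: dvdp0.
- exact: dvdp_add.
rewrite coefZ; apply: (@dvdp_trans _ (p ^+ (m - j) * p ^+ (j - i))).
  by rewrite -exprD dvdp_exp2l //; lia.
by rewrite dvdp_mul // dvdp_coef_exp_XaddC.
Qed.

Lemma vanishes_sum p h m l (q : nat -> {poly F}) (g : nat -> {poly {poly F}}) :
  (forall i, (i <= l)%N -> vanishes p h m (g i)) ->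
  vanishes p h m (\sum_(i < l.+1) q i *: g i).
Proof.
move=> vg j; rewrite linear_sum /= coef_sum; elim/big_ind: _ => [|x y|i _].
- exact: dvdp0.
- exact: dvdp_add.
by rewrite comp_polyZ coefZ; apply: dvdp_mull; apply: vg; case: i => i /=; rewrite ltnS.
Qed.

Lemma dvdXnP k p : reflect (forall i, (i < k)%N -> p`_i = 0) ('X^k %| p).
Proof.
apply: (iffP idP) => [/dvdpP[q ->] i ik|p0]; first by rewrite coefMXn ik.
rewrite -(poly_take_drop k p) (_ : take_poly k p = 0) ?add0r ?dvdp_mulIr //.
by apply/polyP=> i; rewrite coef_take_poly coef0; case: ifP => // /p0.
Qed.

Lemma dvdp_comp_XaddC (a : F) k p :
  ('X^k %| p \Po ('X + a%:P)) = (('X - a%:P) ^+ k %| p).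
Proof.
apply/idP/idP=> [/(dvdp_comp_poly ('X - a%:P))|/(dvdp_comp_poly ('X + a%:P))].
  rewrite -comp_polyA comp_polyD comp_polyX comp_polyC subrK comp_polyXr.
  by rewrite comp_Xn_poly.
by rewrite rmorphXn /= comp_polyB comp_polyX comp_polyC addrK.
Qed.

Lemma coef_translate (a b : F) f j :
  (translate a b f)`_j = (f \Po ('X + b%:P%:P))`_j \Po ('X + a%:P).
Proof.
rewrite -(coef_map (comp_poly ('X + a%:P))) map_comp_poly.
by rewrite rmorphD /= map_polyX map_polyC /= comp_polyC.
Qed.

Lemma translate_eq0 (a b : F) f : translate a b f = 0 -> f = 0.
Proof.
move=> t0; rewrite -(comp_XaddCK f b%:P).
rewrite (_ : f \Po _ = 0) ?comp_poly0 //; apply/polyP=> j; rewrite coef0.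
rewrite -[LHS](comp_polyXr) -[X in _ \Po X](_ : ('X + a%:P) \Po ('X - a%:P) = 'X).
  by rewrite comp_polyA -coef_translate t0 coef0 comp_poly0.
by rewrite comp_polyD comp_polyX comp_polyC subrK.
Qed.

Lemma leq_bigmin (d0 : nat) s m :
  (m <= \big[minn/d0]_(d <- s) d)%N = (m <= d0)%N && all (leq m) s.
Proof.
elim: s => [|d s IH]; first by rewrite big_nil andbT.
by rewrite big_cons leq_min IH /=; lia.
Qed.

(** After translation no [x^i y^j] with [i + j < m] may occur, that is, [x^(m - j)] divides the
    coefficient of [y^j]. *)
Lemma leq_mult (a b : F) f m : f != 0 ->
  (m <= mult a b f)%N <-> vanishes ('X - a%:P) b%:P m f.
Proof.
move=> f0; rewrite /mult leq_bigmin; set tf := translate a b f.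
have tf0 : tf != 0 by apply: contraNneq f0 => /translate_eq0 ->.
(* The default of the minimum is the head of a nonempty list, hence one of its members. *)
have -> : (m <= head 0 [seq t.1 + t.2 | t <- supp tf])%N &&
          all (leq m) [seq (t.1 + t.2)%N | t <- supp tf]
        = all (fun t => m <= t.1 + t.2)%N (supp tf).
  rewrite all_map; have [t] := supp_neq0 tf0.
  by case: (supp tf) => //= t' s _; rewrite andbA andbb.
split=> [/allP ge j|van].
  rewrite -dvdp_comp_XaddC -coef_translate; apply/dvdXnP=> i ij; apply/eqP.
  apply: contraTT isT => nz; have /ge/= : (i, j) \in supp tf by rewrite mem_supp.
  by lia.
apply/allP=> -[i j]; rewrite mem_supp /= => nz; rewrite leqNgt.
apply: contra nz => lt; have := van j; rewrite -dvdp_comp_XaddC -coef_translate.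
by move=> /dvdXnP -> //; lia.
Qed.

End Vanishing.

(** * Interpolation and gluing of the conditions at the points *)

Section Interpolation.

Variables (F : fieldType) (n : nat) (alpha : 'I_n -> F) (v : 'rV[F]_n).
Hypothesis alpha_inj : injective alpha.

Local Notation h := (hvec alpha v).

Lemma htilde_neq0 i : (htilde alpha i).[alpha i] != 0.
Proof.
rewrite /htilde horner_prod; apply/prodf_neq0 => j ji.
by rewrite hornerXsubC subr_eq0; apply: contra ji => /eqP /alpha_inj ->.
Qed.

Lemma hvec_eval i : h.[alpha i] = v 0 i.
Proof.
rewrite /hvec horner_sum (bigD1 i) //= big1 ?addr0 => [|j ji].
  by rewrite !hornerZ mulVf ?mulr1 // htilde_neq0.
suff ht0 : (htilde alpha j).[alpha i] = 0 by rewrite !hornerZ ht0 !mulr0.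
rewrite /htilde horner_prod (bigD1 i) /=; last by rewrite eq_sym.
by rewrite hornerXsubC subrr mul0r.
Qed.

Lemma size_eta : size (eta alpha) = n.+1.
Proof. by rewrite /eta size_prod_XsubC /index_enum -enumT size_enum_ord. Qed.

Lemma size_htilde i : size (htilde alpha i) = n.
Proof.
have ht0 : htilde alpha i != 0.
  by apply: contraNneq (htilde_neq0 i) => ->; rewrite horner0.
apply: succn_inj; rewrite -size_eta /eta (bigD1 i) //= size_mul ?polyXsubC_eq0 //.
by rewrite size_XsubC.
Qed.

Lemma size_hvec : (size h <= n)%N.
Proof.
apply: leq_trans (size_sum _ _ _) _; apply/bigmax_leqP => i _.
by do 2! (apply: leq_trans (size_scale_leq _ _) _); rewrite size_htilde.
Qed.

(** The powers of [x - alpha_i] are pairwise coprime because the [alpha_i] are distinct. *)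
Lemma eta_exp_dvdp k q :
  (forall i, ('X - (alpha i)%:P) ^+ k %| q) <-> eta alpha ^+ k %| q.
Proof.
rewrite /eta -prodrXl; split=> [dv|dv i]; last first.
  by apply: dvdp_trans dv; rewrite (bigD1 i) //= dvdp_mulIl.
elim: (index_enum _) (index_enum_uniq 'I_n) => [|i s IH] /=.
  by rewrite big_nil dvd1p.
case/andP=> is_ us; rewrite big_cons Gauss_dvdp ?dv ?IH //.
rewrite big_seq; elim/big_ind: _ => [|x y cx cy|j js].
- exact: coprimep1.
- by rewrite coprimepMr cx.
rewrite coprimep_expl // coprimep_expr // coprimep_XsubC root_XsubC.
by apply: contra is_ => /eqP /alpha_inj <-.
Qed.

(** At each point the centre [v_i] may be replaced by [h], as they agree modulo [x - alpha_i];
    coprimality then merges the local conditions into one. *)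
Lemma in_I_vanishes m f : in_I alpha v m f <-> vanishes (eta alpha) h m f.
Proof.
have dvh i : 'X - (alpha i)%:P %| h - (v 0 i)%:P.
  by rewrite dvdp_XsubCl /root hornerD hornerN hornerC hvec_eval subrr.
have -> : in_I alpha v m f <->
          forall i, vanishes ('X - (alpha i)%:P) (v 0 i)%:P m f.
  split=> [[-> i j|fi i]|vi].
  - by rewrite comp_poly0 coef0 dvdp0.
  - case: (eqVneq f 0) => [-> j|f0]; first by rewrite comp_poly0 coef0 dvdp0.
    by rewrite -leq_mult.
  case: (eqVneq f 0) => [|f0]; first by left.
  by right=> i; apply/leq_mult.
split=> [vi j|ve i].
  apply/eta_exp_dvdp=> i; have := vanishes_shift (dvh i) (vi i).
  by rewrite subrKC; apply.
have dvh' : 'X - (alpha i)%:P %| (v 0 i)%:P - h by rewrite -dvdpNr opprB.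
rewrite -[(v 0 i)%:P](subrKC h); apply: vanishes_shift => // j.
exact: (proj2 (eta_exp_dvdp _ _) (ve j)).
Qed.

End Interpolation.

(** * Bases of submodules *)

Section Basis.

Variables (R : comNzRingType) (V : lmodType R) (l : nat).
Implicit Types (p : nat -> R) (g : nat -> V) (M : V -> Prop).

Definition comb p g : V := \sum_(i < l.+1) p i *: g i.

(** Families are indexed by [nat], like the program variables, and only indices up to [l] count. *)
Definition is_basis M g :=
  [/\ forall p, M (comb p g),
      forall f, M f -> exists p, f = comb p g &
      forall p, comb p g = 0 -> forall i, (i <= l)%N -> p i = 0].

(** I6 touches two generators only, so comparing combinations before and after it reduces to two
    summands. *)
Lemma comb_eq2 p g p' g' r s : (r <= l)%N -> (s <= l)%N -> r != s ->
  (forall i, i != r -> i != s -> p i *: g i = p' i *: g' i) ->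
  p r *: g r + p s *: g s = p' r *: g' r + p' s *: g' s ->
  comb p g = comb p' g'.
Proof.
move=> rl sl rs eqo eqrs.
have split2 q f : comb q f = q r *: f r + q s *: f s +
    \sum_(i < l.+1 | ((i : nat) != r) && ((i : nat) != s)) q i *: f i.
  rewrite /comb (bigD1 (Ordinal (rl : (r < l.+1)%N))) //=.
  rewrite (bigD1 (Ordinal (sl : (s < l.+1)%N))) /=; last by rewrite eq_sym.
  by rewrite addrA; congr (_ + _); apply: eq_bigl => i; rewrite -!val_eqE.
by rewrite !split2 eqrs; congr (_ + _); apply: eq_bigr => i /andP[ir si]; apply: eqo.
Qed.

Lemma comb_delta g i : (i <= l)%N -> comb (fun j => (j == i)%:R) g = g i.
Proof.
move=> il; rewrite /comb (bigD1 (Ordinal (il : (i < l.+1)%N))) //= eqxx scale1r.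
rewrite big1 ?addr0 // => j ji; rewrite (_ : (j : nat) == i = false) ?scale0r //.
by apply: contraNF ji => /eqP ji; apply/eqP/val_inj.
Qed.

Lemma basis_mem M g i : is_basis M g -> (i <= l)%N -> M (g i).
Proof. by case=> Mg _ _ il; rewrite -(comb_delta g il); apply: Mg. Qed.

Lemma basis_neq0 M g i : is_basis M g -> (i <= l)%N -> g i != 0.
Proof.
case=> _ _ fr il; apply/eqP; rewrite -(comb_delta g il) => /fr /(_ i il).
by move/eqP; rewrite eqxx oner_eq0.
Qed.

(** The coefficients change by adding a multiple of the r-th to the s-th, which the opposite
    multiple undoes. *)
Lemma basis_sub M g r s q : is_basis M g -> (r <= l)%N -> (s <= l)%N -> r != s ->
  is_basis M [eta g with r |-> g r - q *: g s].
Proof.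
move=> [Mg gM fr] rl sl rs; set g' : nat -> V := [eta g with r |-> _].
have sr : (s == r) = false by rewrite eq_sym; apply: negbTE.
have comb' p : comb p g' = comb [eta p with s |-> p s - p r * q] g.
  apply: (comb_eq2 rl sl rs) => [i ir si|] /=.
    by rewrite /g' /= (negbTE ir) (negbTE si).
  rewrite /g' /= !eqxx sr (negbTE rs) scalerBr scalerBl !scalerA -!addrA.
  by congr (_ + _); rewrite addrC.
split=> [p|f /gM[p ->]|p]; first by rewrite comb'.
  exists [eta p with s |-> p s + p r * q]; rewrite comb'.
  apply: (comb_eq2 rl sl rs) => [i ir si|] /=.
    by rewrite !(negbTE si).
  by rewrite !eqxx (negbTE rs) addrK.
rewrite comb' => /fr p0 i il; have /= := p0 r rl; rewrite (negbTE rs) => pr0.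
have /= := p0 s sl; rewrite eqxx pr0 mul0r subr0 => ps0.
by case: (eqVneq i s) => [-> //|si]; have /= := p0 i il; rewrite (negbTE si).
Qed.

(** The coefficients at [r] and [s] become [p s + p r * q] and [- (p r * c)]; this map is invertible
    since [c] has inverse [c']. *)
Lemma basis_swap M g r s q c c' : is_basis M g -> (r <= l)%N -> (s <= l)%N ->
  r != s -> c' * c = 1 ->
  is_basis M [eta g with s |-> g r, r |-> q *: g r - c *: g s].
Proof.
move=> [Mg gM fr] rl sl rs cc'; set g' : nat -> V := [eta g with s |-> _, _ |-> _].
have sr : (s == r) = false by rewrite eq_sym; apply: negbTE.
have comb' p :
    comb p g' = comb [eta p with r |-> p s + p r * q, s |-> - (p r * c)] g.
  apply: (comb_eq2 rl sl rs) => [i ir si|] /=.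
    by rewrite /g' /= (negbTE ir) (negbTE si).
  rewrite /g' /= !eqxx sr (negbTE rs) scalerBr scalerDl scaleNr !scalerA.
  by rewrite addrC addrA.
split=> [p|f /gM[p ->]|p]; first by rewrite comb'.
  exists [eta p with r |-> - (p s * c'), s |-> p r + p s * c' * q]; rewrite comb'.
  apply: (comb_eq2 rl sl rs) => [i ir si|] /=.
    by rewrite !(negbTE si) !(negbTE ir).
  by rewrite !eqxx sr !mulNr addrK opprK -mulrA cc' mulr1.
rewrite comb' => /fr p0.
have /= := p0 s sl; rewrite eqxx sr => /eqP; rewrite oppr_eq0 => /eqP prc.
have pr0 : p r = 0 by rewrite -[p r]mulr1 -cc' mulrCA prc mulr0.
have /= := p0 r rl; rewrite eqxx pr0 mul0r addr0 => ps0 i il.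
case: (eqVneq i s) => [-> //|si]; case: (eqVneq i r) => [-> //|ir].
by have /= := p0 i il; rewrite (negbTE si) (negbTE ir).
Qed.

End Basis.

(** * Minimal elements from a basis with distinct leading y-degrees *)

Section MinimalElement.

Variables (F : fieldType) (u l : nat).
Implicit Types (M : {poly {poly F}} -> Prop) (g : nat -> {poly {poly F}}).

(** The top power of y occurs only in the last generator, with nonzero coefficient, so the
    multiplier of that generator vanishes; then induct. *)
Lemma triangular_free g (p : nat -> {poly F}) :
  (forall i, (i <= l)%N -> size (g i) = i.+1) ->
  comb l p g = 0 -> forall i, (i <= l)%N -> p i = 0.
Proof.
rewrite /comb; elim: l => [|k IH] sg.
  rewrite big_ord1 => /eqP; rewrite scale_poly_eq0.
  rewrite -size_poly_eq0 sg // orbF => /eqP p0 i; rewrite leqn0 => /eqP -> //.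
rewrite big_ord_recr /= => s0.
have pk : p k.+1 = 0.
  have /(congr1 (fun f : {poly {poly F}} => f`_k.+1)) := s0.
  rewrite coefD coef_sum big1 => [|i _]; last first.
    by have ik := ltn_ord i; rewrite coefZ nth_default ?mulr0 // sg // ltnW.
  rewrite add0r coefZ coef0 => /eqP; rewrite mulf_eq0 => /orP[/eqP //|].
  have -> : (g k.+1)`_k.+1 = lead_coef (g k.+1) by rewrite lead_coefE sg.
  by rewrite lead_coef_eq0 -size_poly_eq0 sg.
move: s0; rewrite pk scale0r addr0 => /(IH _) h i.
rewrite leq_eqVlt => /orP[/eqP -> //|]; rewrite ltnS; apply: h => j jk.
by apply: sg; apply: leqW.
Qed.

Lemma basis_minimal M g i0 : is_basis l M g ->
  (forall i, (i <= l)%N -> (lmon u (g i)).2 = i) -> (i0 <= l)%N ->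
  (forall i, (i <= l)%N -> mon_le u (lmon u (g i0)) (lmon u (g i))) ->
  minimal_polynomial u M (g i0).
Proof.
move=> bg ly il0 min0; split; [exact: basis_mem bg il0 | exact: basis_neq0 bg il0 |].
case: (bg) => _ gen _ f /gen[p ->] {f} c0.
have [i1 pi1] : exists i : 'I_l.+1, p i != 0.
  apply/existsP; apply: contraNT c0; rewrite negb_exists => /forallP p0.
  rewrite /comb big1 // => i _; have := p0 i; rewrite negbK => /eqP ->.
  by rewrite scale0r.
have g0 (i : 'I_l.+1) : g i != 0 by apply: (basis_neq0 bg); rewrite -ltnS.
pose T (j : 'I_l.+1) := lmon u (p j *: g j).
(* A summand with largest leading monomial is chosen. [extremumP] yields a least element, hence the
   reversed order [ge]. *)
have [i pi imax] : exists2 i : 'I_l.+1, p i != 0 &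
    forall j : 'I_l.+1, p j != 0 -> mon_le u (T j) (T i).
  pose ge t t' := mon_le u t' t.
  have ge_refl : reflexive ge by move=> t; apply: mon_le_refl.
  have ge_trans : transitive ge by move=> t t1 t2 /[swap]; apply: mon_le_trans.
  have ge_total : total ge by move=> t1 t2; apply: mon_le_total.
  have [i pi imax] := extremumP (P := fun j : 'I_l.+1 => p j != 0) T
    ge_refl ge_trans ge_total pi1.
  by exists i.
have Ti : T i = ((lmon u (g i)).1 + deg (p i), (lmon u (g i)).2)%N.
  exact: lmon_scale.
apply: mon_le_trans (min0 i _) _; first by rewrite -ltnS.
apply: (@mon_le_trans _ (T i)); first by rewrite Ti mon_le_addl.
apply: lmon_max; rewrite mem_supp /comb coef_sum coef_sum (bigD1 i) //=.
rewrite big1 ?addr0 => [|j ji].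
  by rewrite -mem_supp lmon_supp // scale_poly_eq0 negb_or pi g0.
have [pj|pj] := eqVneq (p j) 0; first by rewrite pj scale0r !coef0.
(* If [T i] occurred in the j-th summand, [T i] and [T j] would be equal, while their y-degrees are
   [i] and [j]. *)
apply: contraNeq ji => nz; rewrite -val_eqE /=.
have /imax Tji := pj.
have tij : T i \in supp (p j *: g j) by rewrite mem_supp.
have eT := mon_le_anti Tji (lmon_max u tij).
have : (T j).2 = (T i).2 by rewrite eT.
by rewrite /T !lmon_scale //= !ly ?leq_ord // => ->.
Qed.

End MinimalElement.

(** * The initial basis *)

Section InitialBasis.

Variables (F : fieldType) (n m l : nat) (alpha : 'I_n -> F) (v : 'rV[F]_n).
Hypotheses (alpha_inj : injective alpha) (leml : (m <= l)%N).

Local Notation h := (hvec alpha v).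
Local Notation G := (I2_gen m alpha h).

Lemma size_I2_gen i : size (G i) = i.+1.
Proof.
rewrite /I2_gen; case: leqP => im.
  have eta0 : eta alpha != 0 by rewrite -size_poly_eq0 size_eta.
  by rewrite size_scale ?expf_neq0 // size_exp_XsubC.
rewrite mulrC size_mulXn; last by rewrite -size_poly_eq0 size_exp_XsubC.
by rewrite size_exp_XsubC addnS subnK // ltnW.
Qed.

(** Substituting [y + h] for y turns the generators into [eta^(m - i) y^i] and, for [i > m], into
    multiples of [y^m]. *)
Lemma vanishes_I2_gen i : vanishes (eta alpha) h m (G i).
Proof.
move=> j; rewrite /I2_gen; case: leqP => im.
  rewrite comp_polyZ rmorphXn /= comp_XsubC_Xadd coefZ coefXn.
  by case: eqP => [->|_]; rewrite ?mulr0 ?dvdp0 ?mulr1.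
rewrite comp_polyM rmorphXn rmorphXn /= comp_XsubC_Xadd coefMXn.
case: ltnP => [|jm]; first by rewrite dvdp0.
by rewrite (eqP jm) expr0 dvd1p.
Qed.

Lemma in_Il_vanishes f :
  in_Il alpha v m l f <-> vanishes (eta alpha) h m f /\ (size f <= l.+1)%N.
Proof. by rewrite /in_Il in_I_vanishes. Qed.

Lemma I2_gen_span f : in_Il alpha v m l f -> exists p, f = comb l p G.
Proof.
move/in_Il_vanishes=> [vf sf]; set T := f \Po ('X + h%:P) in vf.
have sT : (size T <= l.+1)%N.
  by rewrite /T -[h]opprK polyCN size_comp_poly2 ?size_XsubC.
(* [T] is split at [y^m]. Its low coefficients are divisible by [eta^(m - i)]; its high part,
   shifted back, is [q (y - h)^m], and the powers of y in [q] match the generators of index at least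
   [m]. *)
pose q := drop_poly m T \Po ('X - h%:P).
have sq : (size q <= l.+1 - m)%N.
  by rewrite size_comp_poly2 ?size_XsubC // size_drop_poly leq_sub2r.
pose p i := if (i < m)%N then T`_i %/ eta alpha ^+ (m - i) else q`_(i - m).
exists p; rewrite /comb -(big_mkord xpredT (fun i => p i *: G i)).
rewrite (big_cat_nat _ (leqW leml)) //=.
rewrite -(comp_XaddCK f h) -/T -[in LHS](poly_take_drop m T) comp_polyD comp_polyM.
rewrite comp_Xn_poly -/q; congr (_ + _).
  rewrite /take_poly poly_def linear_sum /= big_mkord; apply: eq_bigr => i _.
  rewrite comp_polyZ comp_Xn_poly /p /I2_gen ltn_ord ltnW ?ltn_ord //.
  by rewrite scalerA divpK //; apply: vf.
rewrite -{1}(take_poly_id sq) /take_poly poly_def mulr_suml.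
rewrite -[X in index_iota X _]add0n big_addn big_mkord.
apply: eq_bigr => i _; rewrite /p /I2_gen addnK.
rewrite ltnNge leq_addl /= -scalerAl; case: leqP => // im.
(* At index [m] the first case of [I2_gen] applies, and both formulas give [(y - h)^m]. *)
have -> : (i : nat) = 0%N by lia.
by rewrite add0n subnn !expr0 scale1r mul1r.
Qed.

Lemma I2_gen_basis : is_basis l (in_Il alpha v m l) G.
Proof.
split=> [p||p]; [|exact: I2_gen_span|]; last first.
  by apply: triangular_free => i _; apply: size_I2_gen.
apply/in_Il_vanishes; split.
  by apply: vanishes_sum => i _; apply: vanishes_I2_gen.
apply: leq_trans (size_sum _ _ _) _; apply/bigmax_leqP => i _.
by apply: leq_trans (size_scale_leq _ _) _; rewrite size_I2_gen ltn_ord.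
Qed.

End InitialBasis.

Lemma leq_sum_ord_const n (E : 'I_n -> nat) c :
  (forall i, (E i <= c)%N) -> (\sum_(i < n) E i <= n * c)%N.
Proof.
move=> Ec; rewrite -[X in (X * c)%N]card_ord -sum_nat_const.
by apply: leq_sum => i _.
Qed.

(** * Weighted degree bounds *)

Section WeightedDegree.

Variables (F : fieldType) (u : nat).
Implicit Types (p q h : {poly F}) (f g : {poly {poly F}}).

(** Phrased by vanishing coefficients, the bound covers [f = 0] and passes to products without
    regard to cancellation. *)
Definition wdeg_le w f := forall i j, (w < i + u * j)%N -> f`_j`_i = 0.

Lemma wdeg_leW w w' f : (w <= w')%N -> wdeg_le w f -> wdeg_le w' f.
Proof. by move=> ww' wf i j lt; apply: wf; apply: leq_ltn_trans lt. Qed.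

Lemma wdeg_leM w w' f g : wdeg_le w f -> wdeg_le w' g -> wdeg_le (w + w') (f * g).
Proof.
move=> wf wg i j lt; rewrite coefM coef_sum big1 // => -[a aj] _ /=.
rewrite coefM big1 // => -[b bi] _ /=; rewrite !ltnS in aj bi.
case: (ltnP w (b + u * a)) => [/wf ->|le]; first by rewrite mul0r.
rewrite [X in _ * X]wg ?mulr0 // mulnBr.
by have := leq_mul2l u a j; rewrite aj orbT; lia.
Qed.

Lemma wdeg_le_polyC w p : (size p <= w.+1)%N -> wdeg_le w p%:P.
Proof.
move=> sp i j lt; rewrite coefC; case: eqP => [j0|_]; last by rewrite coef0.
by apply: nth_default; apply: leq_trans sp _; move: lt; rewrite j0 muln0 addn0.
Qed.

Lemma wdeg_leX : wdeg_le u 'X.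
Proof.
move=> i j; rewrite coefX; case: eqP => [->|_]; last by rewrite coef0.
by rewrite muln1 coef1; case: i => //; rewrite add0n ltnn.
Qed.

Lemma wdeg_le_exp w f i : wdeg_le w f -> wdeg_le (w * i) (f ^+ i).
Proof.
move=> wf; elim: i => [|i IH]; last by rewrite exprS mulnS; apply: wdeg_leM.
by rewrite muln0; apply: wdeg_le_polyC; rewrite size_poly1.
Qed.

Lemma wdeg_le_XsubC w h : (u <= w)%N -> (size h <= w.+1)%N ->
  wdeg_le w ('X - h%:P).
Proof.
move=> uw sh i j lt; rewrite !coefB [X in X - _](wdeg_leW uw wdeg_leX) //.
by rewrite (wdeg_le_polyC sh) ?subr0.
Qed.

Lemma size_coef_wdeg w f j : wdeg_le w f -> (size (f`_j)%R <= w.+1)%N.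
Proof. by move=> wf; apply/leq_sizeP=> i lt; apply: wf; lia. Qed.

Lemma lmon_wdeg w f : wdeg_le w f -> (mon_deg u (lmon u f) <= w)%N.
Proof.
have [->|f0] := eqVneq f 0.
  by rewrite /lmon /supp size_poly0 big_nil /mon_deg muln0.
move=> wf; rewrite leqNgt; apply/negP => /wf /eqP; apply/negP.
by rewrite -mem_supp lmon_supp.
Qed.

Lemma wdeg_le_lmon w f : (mon_deg u (lmon u f) <= w)%N -> wdeg_le w f.
Proof.
move=> le i j lt; apply/eqP; apply: contraTT lt => nz.
have /(lmon_max u) : (i, j) \in supp f by rewrite mem_supp.
by rewrite -leqNgt mon_leE /mon_deg /= in le *; lia.
Qed.

Lemma scale_cost_le a b c p f : (size p <= a)%N -> (size f <= c)%N ->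
  (forall j, (size (f`_j)%R <= b)%N) -> (scale_cost p f <= c * (a * b))%N.
Proof.
move=> pa fc fb; apply: (@leq_trans (size f * (a * b)));
  last by rewrite leq_mul2r fc orbT.
by apply: leq_sum_ord_const => j; apply: leq_mul.
Qed.

End WeightedDegree.

(** * Weighted degrees and cost of the initial basis *)

Section InitialCost.

Variables (F : fieldType) (n m l u : nat) (alpha : 'I_n -> F) (v : 'rV[F]_n).
Hypotheses (alpha_inj : injective alpha) (leun : (u <= n)%N).

Local Notation h := (hvec alpha v).
Local Notation G := (I2_gen m alpha h).

Lemma wdeg_XsubC_hvec i : wdeg_le u (n * i) (('X - h%:P) ^+ i).
Proof.
by apply: wdeg_le_exp; apply: wdeg_le_XsubC => //; apply: leqW; apply: size_hvec.
Qed.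

Lemma size_eta_exp i : (size (eta alpha ^+ i) <= (n * i).+1)%N.
Proof. by apply: leq_trans (size_poly_exp_leq _ _) _; rewrite size_eta. Qed.

(** Each of the [m] factors [y - h] or [eta] has weighted degree at most [n]; the extra powers of y
    add at most [u * l]. *)
Lemma wdeg_I2_gen i : (i <= l)%N -> wdeg_le u (u * l + n * m) (G i).
Proof.
move=> il; rewrite /I2_gen; case: leqP => im.
  apply: (@wdeg_leW _ _ (n * (m - i) + n * i)).
    by rewrite -mulnDr subnK // leq_addl.
  rewrite -mul_polyC; apply: wdeg_leM; last exact: wdeg_XsubC_hvec.
  by apply: wdeg_le_polyC; apply: size_eta_exp.
apply: (@wdeg_leW _ _ (u * (i - m) + n * m)).
  by rewrite leq_add2r leq_mul2l; apply/orP; right; lia.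
by apply: wdeg_leM; [apply/wdeg_le_exp/wdeg_leX | apply: wdeg_XsubC_hvec].
Qed.

Lemma I1_cost_le : (I1_cost alpha v <= n * n)%N.
Proof.
apply: leq_sum_ord_const => i.
rewrite /mul_cost -[leqRHS]mul1n leq_mul ?size_polyC_leq1 //.
by apply: leq_trans (size_scale_leq _ _) _; rewrite size_htilde.
Qed.

Lemma I2_cost_le : (I2_cost m alpha h <=
  m * (m * (n * (n * m).+1)) + m.+1 * (m.+1 * ((n * m).+1 * (n * m).+1)))%N.
Proof.
have szc i j : (i <= m)%N -> (size ((('X - h%:P) ^+ i)`_j)%R <= (n * m).+1)%N.
  move=> im; have /leq_trans := size_coef_wdeg j (@wdeg_XsubC_hvec i); apply.
  by rewrite ltnS leq_mul2l im orbT.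
rewrite /I2_cost; apply: leq_add.
  apply: leq_sum_ord_const => -[i im] /=.
  apply: scale_cost_le => [||j]; first exact: size_hvec.
    by rewrite size_exp_XsubC.
  by apply: szc; apply: ltnW.
apply: leq_sum_ord_const => -[i im] /=.
apply: scale_cost_le => [||j].
- by apply: leq_trans (size_eta_exp _) _; rewrite ltnS leq_mul2l leq_subr orbT.
- by rewrite size_exp_XsubC.
- exact: szc.
Qed.

End InitialCost.

(** * The main loop *)

Lemma ltn_sum2 l (E E' : nat -> nat) r s : (r <= l)%N -> (s <= l)%N -> r != s ->
  (forall i, i != r -> i != s -> E' i = E i) -> (E' r + E' s < E r + E s)%N ->
  (\sum_(i < l.+1) E' i < \sum_(i < l.+1) E i)%N.
Proof.
move=> rl sl rs eqo lt.
have split2 f : (\sum_(i < l.+1) f (i : nat) = f r + f s +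
    \sum_(i < l.+1 | ((i : nat) != r) && ((i : nat) != s)) f i)%N.
  rewrite (bigD1 (Ordinal (rl : (r < l.+1)%N))) //=.
  rewrite (bigD1 (Ordinal (sl : (s < l.+1)%N))) /=; last by rewrite eq_sym.
  by rewrite addnA; congr (_ + _)%N; apply: eq_bigl => i; rewrite -!val_eqE.
rewrite (split2 E) (split2 E').
have -> : (\sum_(i < l.+1 | ((i : nat) != r) && ((i : nat) != s)) E' i =
           \sum_(i < l.+1 | ((i : nat) != r) && ((i : nat) != s)) E i)%N.
  by apply: eq_bigr => i /andP[ir si]; apply: eqo.
by rewrite ltn_add2r.
Qed.

Section Loop.

Variables (F : fieldType) (n k m l : nat) (alpha : 'I_n -> F) (v : 'rV[F]_n).
Variables (M : {poly {poly F}} -> Prop) (w : nat).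

Local Notation u := k.-1.
Local Notation step := (@step F n k m l alpha v).

(** Generators below the current index [r] already have leading y-degree equal to their index. The
    size bound keeps [g r] within y-degree [r], so a wrong value of [s] is smaller than [r]; earlier
    generators may reach y-degree [r] through swaps. *)
Definition loop_inv (g : nat -> {poly {poly F}}) (r : nat) :=
  [/\ is_basis l M g,
      forall i, (i < r)%N -> (i <= l)%N -> (lmon u (g i)).2 = i,
      forall i, (i <= l)%N -> (size (g i) <= (maxn i r).+1)%N &
      forall i, (i <= l)%N -> wdeg_le u w (g i)].

Definition potential (g : nat -> {poly {poly F}}) : nat :=
  \sum_(i < l.+1) mon_rank u l (lmon u (g i)).

(** Cost of one pass: [c] times at most [l.+1] coefficients of size at most [w.+1], and one
    multiplication in I5. *)
Definition step_bound : nat := (l.+1 * w.+1).+1.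

Section OneStep.

Variables (g : nat -> {poly {poly F}}) (r s : nat).
Hypotheses (inv_g : loop_inv g r) (rl : (r <= l)%N).
Hypotheses (s_def : s = (lmon u (g r)).2) (sr : s != r).

Local Notation ars := (g r)`_s.
Local Notation ass := (g s)`_s.
Local Notation c := (lead_coef ars * (lead_coef ass)^-1).

Lemma loop_s_ltr : (s < r)%N.
Proof.
case: inv_g => _ _ sz _; rewrite ltn_neqAle sr s_def.
by apply: lmon_size; have := sz r rl; rewrite maxnn.
Qed.

Lemma loop_sl : (s <= l)%N.
Proof. by apply: leq_trans rl; apply: ltnW; apply: loop_s_ltr. Qed.

Lemma loop_size i : (i <= r)%N -> (size (g i) <= r.+1)%N.
Proof.
move=> ir; case: inv_g => _ _ sz _; have := sz i (leq_trans ir rl).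
by rewrite (maxn_idPr ir).
Qed.

Lemma loop_lmon_r : ars != 0 /\ lmon u (g r) = (deg ars, s).
Proof.
case: inv_g => bg _ _ _; have [nz dg] := @lmon_coef _ u _ (basis_neq0 bg rl).
by rewrite s_def; split=> //; rewrite dg -surjective_pairing.
Qed.

Lemma loop_lmon_s : ass != 0 /\ lmon u (g s) = (deg ass, s).
Proof.
case: inv_g => bg ly _ _.
have [nz dg] := @lmon_coef _ u _ (basis_neq0 bg loop_sl).
have e := ly s loop_s_ltr loop_sl; rewrite e in nz dg; split=> //.
by rewrite dg [LHS]surjective_pairing e.
Qed.

Lemma loop_c_neq0 : c != 0.
Proof.
have [ars0 _] := loop_lmon_r; have [ass0 _] := loop_lmon_s.
by rewrite mulf_neq0 ?invr_eq0 ?lead_coef_eq0.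
Qed.

Lemma loop_c_mul : c * lead_coef ass = lead_coef ars.
Proof. by have [ass0 _] := loop_lmon_s; rewrite mulfVK ?lead_coef_eq0. Qed.

Lemma loop_lmon_le i : (i <= l)%N -> (mon_deg u (lmon u (g i)) <= w)%N.
Proof. by case: inv_g => _ _ _ wg il; apply: lmon_wdeg; apply: wg. Qed.

(** The multiple of [g s] has the same leading term as [g r], so the leading monomial at [r] drops
    and nothing else changes. *)
Lemma loop_sub : (deg ass <= deg ars)%N ->
  let g' := [eta g with r |-> g r - (c *: 'X^(deg ars - deg ass)) *: g s] in
  loop_inv g' r /\ (potential g' < potential g)%N.
Proof.
move=> le; set q := c *: _; move=> g'.
have [ars0 lr] := loop_lmon_r; have [ass0 ls] := loop_lmon_s.
have [bg ly sz wg] := inv_g.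
have bg' : is_basis l M g' by apply: basis_sub => //; [exact: loop_sl | rewrite eq_sym].
have g'r : g' r = g r - q *: g s by rewrite /g' /= eqxx.
have g'i i : i != r -> g' i = g i by move=> ir; rewrite /g' /= (negbTE ir).
have q0 : q != 0 by rewrite scale_poly_eq0 negb_or loop_c_neq0 -size_poly_eq0 size_polyXn.
have dq : deg q = (deg ars - deg ass)%N.
  by rewrite /q /deg size_scale ?loop_c_neq0 // size_polyXn.
have lt : mon_lt u (lmon u (g' r)) (lmon u (g r)).
  rewrite g'r; apply: lmon_sub_lt => //.
  - by rewrite -g'r; apply: (basis_neq0 bg').
  - by rewrite lmon_scale ?(basis_neq0 bg) ?loop_sl // ls lr /= dq subnKC.
  rewrite lr /= coefZ; have -> : deg ars = deg (q * ass).
    by rewrite degM // dq subnK.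
  rewrite {2}/deg -lead_coefE lead_coefM lead_coefZ lead_coefXn mulr1 loop_c_mul.
  by rewrite degM // dq subnK.
split; last first.
  apply: (@ltn_sum2 _ (fun i => mon_rank u l (lmon u (g i)))
                      (fun i => mon_rank u l (lmon u (g' i))) r s rl loop_sl).
  - by rewrite eq_sym.
  - by move=> i ir _; rewrite g'i.
  rewrite [g' s]g'i // ltn_add2r; apply: mon_rank_lt => //.
  apply: lmon_size; rewrite g'r (leq_trans (size_polyD _ _)) // size_polyN geq_max.
  rewrite (leq_trans (loop_size (leqnn r))) //=.
  apply: leq_trans (size_scale_leq _ _) _.
  by apply: leq_trans (loop_size (ltnW loop_s_ltr)) _.
split=> // [i ir il|i il|i il].
- by rewrite g'i ?ly // neq_ltn ir.
- case: (eqVneq i r) => [->|ir]; last by rewrite g'i ?sz.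
  rewrite g'r maxnn (leq_trans (size_polyD _ _)) // size_polyN geq_max.
  rewrite loop_size //=; apply: leq_trans (size_scale_leq _ _) _.
  by apply: loop_size; apply: ltnW; apply: loop_s_ltr.
case: (eqVneq i r) => [->|ir]; last by rewrite g'i //; apply: wg.
apply: wdeg_le_lmon; apply: leq_trans (loop_lmon_le rl).
by move: lt; rewrite /mon_lt => /orP[/ltnW //|/andP[/eqP ->]].
Qed.

(** Both terms of the difference have the leading monomial of the old [g s], so the new [g r] falls
    below it. The new [g s] is the old [g r], whose leading y-degree is also [s]; the invariant at
    [s] survives. *)
Lemma loop_swap : (deg ars < deg ass)%N ->
  let g' := [eta g with s |-> g r,
               r |-> 'X^(deg ass - deg ars) *: g r - c%:P *: g s] in
  loop_inv g' r /\ (potential g' < potential g)%N.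
Proof.
move=> le; set q := 'X^_; move=> g'.
have [ars0 lr] := loop_lmon_r; have [ass0 ls] := loop_lmon_s.
have [bg ly sz wg] := inv_g.
have rs : r != s by rewrite eq_sym.
have bg' : is_basis l M g'.
  apply: (@basis_swap _ _ l M g r s q c%:P (c^-1)%:P) => //; first exact: loop_sl.
  by rewrite -polyCM mulVf // loop_c_neq0.
have g'r : g' r = q *: g r - c%:P *: g s by rewrite /g' /= eqxx (negbTE rs).
have g's : g' s = g r by rewrite /g' /= eqxx.
have g'i i : i != r -> i != s -> g' i = g i.
  by move=> ir si; rewrite /g' /= (negbTE ir) (negbTE si).
have q0 : q != 0 by rewrite -size_poly_eq0 size_polyXn.
have dq : deg q = (deg ass - deg ars)%N by rewrite /q /deg size_polyXn.
have lt : mon_lt u (lmon u (g' r)) (lmon u (g s)).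
  rewrite g'r; apply: lmon_sub_lt => //.
  - by rewrite -g'r; apply: (basis_neq0 bg').
  - by rewrite lmon_scale ?(basis_neq0 bg) // ls lr /= dq subnKC // ltnW.
  - rewrite lmon_scale ?(basis_neq0 bg) ?loop_sl //; last first.
      by rewrite polyC_eq0 loop_c_neq0.
    by rewrite /deg size_polyC loop_c_neq0 addn0 -surjective_pairing.
  rewrite ls /= !coefZ coefCM coef_deg loop_c_mul.
  have -> : deg ass = deg (q * ars) by rewrite degM // dq subnK // ltnW.
  by rewrite coef_deg lead_coefM lead_coefXn mul1r.
have szr : (size (g' r) <= r.+1)%N.
  rewrite g'r (leq_trans (size_polyD _ _)) // size_polyN geq_max.
  rewrite (leq_trans (size_scale_leq _ _)) ?loop_size //=.
  apply: leq_trans (size_scale_leq _ _) _.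
  by apply: loop_size; apply: ltnW; apply: loop_s_ltr.
split; last first.
  apply: (@ltn_sum2 _ (fun i => mon_rank u l (lmon u (g i)))
                      (fun i => mon_rank u l (lmon u (g' i))) r s rl loop_sl rs).
  - by move=> i ir si; rewrite g'i.
  rewrite g's addnC ltn_add2l; apply: mon_rank_lt => //.
  by apply: lmon_size; apply: leq_trans szr _.
split=> // [i ir il|i il|i il].
- case: (eqVneq i s) => [->|si]; first by rewrite g's lr.
  by rewrite g'i ?ly // neq_ltn ir.
- case: (eqVneq i r) => [->|ir]; first by rewrite maxnn.
  case: (eqVneq i s) => [->|si]; last by rewrite g'i ?sz.
  by rewrite g's (maxn_idPr (ltnW loop_s_ltr)) loop_size.
case: (eqVneq i r) => [->|ir].
  apply: wdeg_le_lmon; apply: leq_trans (loop_lmon_le loop_sl).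
  by move: lt; rewrite /mon_lt => /orP[/ltnW //|/andP[/eqP ->]].
case: (eqVneq i s) => [->|si]; first by rewrite g's; apply: wg.
by rewrite g'i //; apply: wg.
Qed.

Lemma loop_cost : ((scale_cost c%:P (g s)).+1 <= step_bound)%N.
Proof.
rewrite /step_bound ltnS -[w.+1]mul1n; apply: scale_cost_le => [||j].
- exact: size_polyC_leq1.
- by apply: leq_trans (loop_size (ltnW loop_s_ltr)) _.
- by case: inv_g => _ _ _ wg; apply: (size_coef_wdeg _ (wg s loop_sl)).
Qed.

End OneStep.

(** Amortisation: a pass costs at most [step_bound] and lowers the potential, so the count plus
    [step_bound] times the potential never grows. [N] bounds the potential and drives the
    induction. *)
Lemma run_I4 N g r h s d c out cnt :
  (potential g < N)%N -> loop_inv g r -> (r <= l)%N ->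
  exists t g' s' d' c' cnt',
    [/\ iter t step (State I4 h g r s d c out cnt) =
          State I3 h g' r s' d' c' out cnt',
        loop_inv g' r.+1 &
        (cnt' + step_bound * potential g' <= cnt + step_bound * potential g)%N].
Proof.
elim: N g s d c cnt => // N IH g s d c cnt potN inv_g rl.
have [e|ne] := eqVneq (lmon u (g r)).2 r.
  exists 1%N, g, (lmon u (g r)).2, d, c, cnt; split=> //=; first by rewrite e eqxx.
  case: inv_g => bg ly sz wg; split=> // i.
    by rewrite ltnS leq_eqVlt => /orP[/eqP -> //|]; apply: ly.
  by move=> /sz /leq_trans; apply; rewrite ltnS geq_max leq_maxl leq_max leqnSn orbT.
set s' := (lmon u (g r)).2 in ne.
set c' := lead_coef (g r)`_s' * (lead_coef (g s')`_s')^-1.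
set d' := (deg (g r)`_s')%:Z - (deg (g s')`_s')%:Z.
(* One pass through I4, I5 and I6; the sign of [d'] selects the branch. *)
have [g' [step3 inv' pot']] : exists g', [/\
    iter 3 step (State I4 h g r s d c out cnt) =
    State I4 h g' r s' d' c' out (cnt + 1 + scale_cost c'%:P (g s')),
    loop_inv g' r & (potential g' < potential g)%N].
  rewrite /= (negbTE ne) /= -/s' -/c' -/d'.
  have [le|lt] := leqP (deg (g s')`_s') (deg (g r)`_s').
    rewrite (_ : 0 <= d' = true); last by rewrite /d'; lia.
    rewrite (_ : `|d'|%N = deg (g r)`_s' - deg (g s')`_s')%N; last by rewrite /d'; lia.
    by have [] := loop_sub inv_g rl erefl ne le; eexists; split.
  rewrite (_ : 0 <= d' = false); last by rewrite /d'; lia.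
  rewrite (_ : `|d'|%N = deg (g s')`_s' - deg (g r)`_s')%N; last by rewrite /d'; lia.
  by have [] := loop_swap inv_g rl erefl ne lt; eexists; split.
have [t [g2 [s2 [d2 [c2 [cnt2 [run inv2 cost2]]]]]]] :=
  IH g' s' d' c' (cnt + 1 + scale_cost c'%:P (g s'))%N (leq_trans pot' potN) inv' rl.
exists (t + 3)%N, g2, s2, d2, c2, cnt2; split=> //; first by rewrite iterD step3.
apply: leq_trans cost2 _; have := loop_cost inv_g rl erefl ne.
have := leq_mul2l step_bound (potential g').+1 (potential g).
by rewrite pot' orbT mulnS -/s' -/c'; lia.
Qed.

(** [j] counts the indices still to be processed. The invariant is one index ahead of the program
    variable, which I3 is about to increase. *)
Lemma run_I3 j g r h s d c out cnt :
  (r + j = l)%N -> loop_inv g r.+1 ->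
  exists t st, [/\ iter t step (State I3 h g r s d c out cnt) = st,
    st_label st = Stop, minimal_polynomial u M (st_out st) &
    (st_count st <= cnt + step_bound * potential g)%N].
Proof.
elim: j g r s d c cnt => [|j IH] g r s d c cnt rj inv_g.
  (* The two steps are I3 and I7; the invariant at [l.+1] makes all leading y-degrees distinct. *)
  rewrite addn0 in rj; exists 2%N, (iter 2 step (State I3 h g r s d c out cnt)).
  rewrite /= rj ltnn /=; split=> //; last exact: leq_addr.
  case: extremumP => [t|t1 t2 t3|t1 t2|//|i _ imin].
  - exact: mon_le_refl.
  - exact: mon_le_trans.
  - exact: mon_le_total.
  have [bg ly _ _] := inv_g.
  apply: basis_minimal bg _ _ _ => [i' il||i' il]; last 1 first.
  - exact: (imin (Ordinal (il : (i' < l.+1)%N))).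
  - by apply: ly => //; rewrite rj.
  - exact: leq_ord.
have rl : (r.+1 <= l)%N by lia.
have [t [g2 [s2 [d2 [c2 [cnt2 [run inv2 cost2]]]]]]] :=
  @run_I4 _ g r.+1 h s d c out cnt (ltnSn _) inv_g rl.
have [|t' [st [run' lab min cost]]] := IH g2 r.+1 s2 d2 c2 cnt2 _ inv2; first by lia.
exists (t' + (t + 1))%N, st; split=> //; last exact: leq_trans cost cost2.
by rewrite iterD iterD /= rl run run'.
Qed.

Lemma potential_bound g r : loop_inv g r ->
  (forall i, (i <= l)%N -> (size (g i) <= l.+1)%N) ->
  (potential g <= l.+1 * (w.+1 * l.+1))%N.
Proof.
case=> _ _ _ wg sg; apply: leq_sum_ord_const => i.
have il : (i <= l)%N by apply: leq_ord.
by apply: mon_rank_bound; [apply: lmon_size; apply: sg | apply: lmon_wdeg; apply: wg].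
Qed.

End Loop.

(** * Cost estimates *)

(** Squaring gives [(z + 1/2)^2 < b/u + 1/4], that is, [z (z + 1) < b/u]. *)
Lemma lt_sqrt_quadratic (R : realType) (b u z : nat) : (0 < u)%N ->
  (z%:R < Num.sqrt (b%:R / u%:R + 4%:R^-1) - 2%:R^-1 :> R) =
  (u * (z * z.+1) < b)%N.
Proof.
move=> u0; have u0' : 0 < u%:R :> R by rewrite ltr0n.
rewrite ltrBrDr -[z%:R + _]ger0_norm; last by rewrite addr_ge0 ?ler0n ?invr_ge0.
rewrite -sqrtr_sqr ltr_sqrt; last by rewrite ltr_wpDl ?divr_ge0 ?ler0n ?invr_gt0.
have -> : (z%:R + 2%:R^-1) ^+ 2 = (z * z.+1)%:R + 4%:R^-1 :> R.
  by rewrite natrM -natr1; field.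
by rewrite ltrD2r ltr_pdivlMr // mulrC -natrM ltr_nat.
Qed.

Lemma quadratic_bounds n k m l : (2 <= k)%N -> (k < n)%N -> (1 <= m)%N ->
  (m <= l)%N -> (k.-1 * (l * l.+1) < 2 * (n * 'C(m.+1, 2) + 1))%N ->
  (k.-1 * l <= n * m)%N /\ (k ^ 2 * l ^ 3 <= 36 * (n ^ 2 * m ^ 3))%N.
Proof.
move=> k2 kn m1 ml; have : (2 * 'C(m.+1, 2) = m.+1 * m)%N.
  by rewrite -mul_bin_diag bin1.
rewrite mulnDr (mulnCA 2) => ->; set u := k.-1 => lt.
have ku : (k <= 2 * u)%N by rewrite /u; lia.
split.
  (* Otherwise [u l (l + 1) >= (n m + 1) (m + 1) >= n m (m + 1) + 2], against the bound on [l]. *)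
  rewrite leqNgt; apply/negP => gt.
  have : ((n * m).+1 * m.+1 <= u * l * l.+1)%N by rewrite leq_mul.
  by nia.
(* The left side is at most [2 u l (l + 1)], hence at most [2 (n m (m + 1) + 1)]. *)
have ul : (k * l ^ 2 <= 6 * (n * m ^ 2))%N by nia.
(* The extra factor [m] is at most [l], so the square of the previous bound applies; [m] is
   cancelled afterwards. *)
have sq : (k ^ 2 * l ^ 3 * m <= 36 * (n ^ 2 * m ^ 3) * m)%N.
  apply: (@leq_trans (k * l ^ 2 * (k * l ^ 2))).
    by rewrite -!mulnn; nia.
  apply: leq_trans (leq_mul ul ul) _; rewrite leq_eqVlt; apply/orP; left.
  by apply/eqP; ring.
by rewrite leq_pmul2r in sq.
Qed.

(** With [a = n m], a pass costs at most [7 l a] and the potential is at most [12 l^2 a]; the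
    product [84 a^2 l^3] contributes [84 * 36 = 3024]. Initialisation contributes [1 + 2 + 16 = 19],
    using [k <= n]. *)
Lemma total_cost_bound n k m l w cost : (k < n)%N -> (1 <= m)%N -> (m <= l)%N ->
  (w <= 2 * (n * m))%N -> (k ^ 2 * l ^ 3 <= 36 * (n ^ 2 * m ^ 3))%N ->
  (cost <= n * n
    + (m * (m * (n * (n * m).+1)) + m.+1 * (m.+1 * ((n * m).+1 * (n * m).+1)))
    + step_bound l w * (l.+1 * (w.+1 * l.+1)))%N ->
  (k ^ 2 * cost <= 3043 * (n ^ 4 * m ^ 5))%N.
Proof.
move=> kn m1 ml wnm kl costE.
have a1 : (1 <= n * m)%N by rewrite muln_gt0; apply/andP; split; lia.
set a := (n * m)%N in a1 wnm costE.
have w3 : (w.+1 <= 3 * a)%N by lia.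
have l2 : (l.+1 <= 2 * l)%N by lia.
have K7 : (step_bound l w <= 7 * (l * a))%N.
  by have := leq_mul l2 w3; rewrite /step_bound; nia.
have P12 : (l.+1 * (w.+1 * l.+1) <= 12 * (l ^ 2 * a))%N.
  have := leq_mul l2 (leq_mul w3 l2); move/leq_trans; apply.
  by rewrite leq_eqVlt; apply/orP; left; apply/eqP; ring.
have loop : (k ^ 2 * (step_bound l w * (l.+1 * (w.+1 * l.+1))) <=
             3024 * (n ^ 4 * m ^ 5))%N.
  apply: (@leq_trans (84 * a ^ 2 * (k ^ 2 * l ^ 3))).
    have := leq_mul (leqnn (k ^ 2)) (leq_mul K7 P12); move/leq_trans; apply.
    by rewrite leq_eqVlt; apply/orP; left; apply/eqP; ring.
  apply: leq_trans (leq_mul (leqnn _) kl) _.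
  by rewrite leq_eqVlt; apply/orP; left; apply/eqP; rewrite /a; ring.
have a2 : (a.+1 <= 2 * a)%N by lia.
have m2 : (m.+1 <= 2 * m)%N by lia.
have init : (n * n + (m * (m * (n * a.+1)) + m.+1 * (m.+1 * (a.+1 * a.+1))) <=
             19 * (n ^ 2 * m ^ 5))%N.
  have c1 : (n * n <= n ^ 2 * m ^ 5)%N by rewrite mulnn leq_pmulr // expn_gt0 m1.
  have c2 : (m * (m * (n * a.+1)) <= 2 * (n ^ 2 * m ^ 5))%N.
    have := leq_mul (leqnn m) (leq_mul (leqnn m) (leq_mul (leqnn n) a2)).
    move/leq_trans; apply; rewrite (_ : _ * _ = 2 * (n ^ 2 * m ^ 3))%N; last first.
      by rewrite /a; ring.
    by apply: leq_mul => //; apply: leq_mul => //; rewrite leq_pexp2l.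
  have c3 : (m.+1 * (m.+1 * (a.+1 * a.+1)) <= 16 * (n ^ 2 * m ^ 5))%N.
    have := leq_mul m2 (leq_mul m2 (leq_mul a2 a2)).
    move/leq_trans; apply; rewrite (_ : _ * _ = 16 * (n ^ 2 * m ^ 4))%N; last first.
      by rewrite /a; ring.
    by apply: leq_mul => //; apply: leq_mul => //; rewrite leq_pexp2l.
  by move: c1 c2 c3; lia.
apply: leq_trans (leq_mul (leqnn _) costE) _; rewrite mulnDr.
have kn2 : (k ^ 2 <= n ^ 2)%N by rewrite leq_sqr ltnW.
apply: leq_trans (leq_add (leq_mul kn2 init) loop) _.
by rewrite leq_eqVlt; apply/orP; left; apply/eqP; ring.
Qed.

(** * Termination, correctness and operation count of the algorithm *)

Theorem mainTheorem1 :
  exists C : nat,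
  forall (R : realType) (F : finFieldType) (n k m l : nat)
    (alpha : 'I_n -> F) (v : 'rV[F]_n),
  (2 <= k)%N -> (k < n)%N -> injective alpha -> (1 <= m)%N ->
  let N := (n * 'C(m.+1, 2) + 1)%N in
  largest_int_below
    (Num.sqrt (2%:R * N%:R / (k%:R - 1) + 4%:R^-1) - 2%:R^-1 : R) l%:Z ->
  exists st : state F,
    [/\ halts_in k m l alpha v st,
        minimal_polynomial k.-1 (in_Il alpha v m l) (st_out st) &
        (st_count st)%:R <= C%:R * (n%:R ^+ 4 * k%:R ^- 2 * m%:R ^+ 5) :> R].
Proof.
exists 3043%N => R F n k m l alpha v k2 kn alpha_inj m1 N.
have k0 : (0 < k.-1)%N by lia.
have -> : k%:R - 1 = k.-1%:R :> R by rewrite -{1}(prednK (ltnW k2)) -natr1 addrK.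
rewrite -natrM => -[lB maxB].
rewrite -pmulrn lt_sqrt_quadratic // in lB.
(* From [k - 1 < n] follows [(k - 1) m (m + 1) < n m (m + 1) + 2], so [m] lies below the bound that
   defines [l]. *)
have ml : (m <= l)%N.
  rewrite -lez_nat; apply: maxB; rewrite -pmulrn lt_sqrt_quadratic //.
  rewrite /N mulnDr (mulnCA 2) -mul_bin_diag bin1 -ltnS; nia.
have [kl kl3] := quadratic_bounds k2 kn m1 ml lB.
set h := hvec alpha v.
(* [w] bounds the weighted degrees of the initial generators and is at most [2 n m] by [kl]. *)
pose w := (k.-1 * l + n * m)%N; pose g := I2_gen m alpha h.
have un : (k.-1 <= n)%N by lia.
have inv_g : loop_inv k l (in_Il alpha v m l) w g 1.
  split=> [|i i0 il|i il|i il].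
  - exact: I2_gen_basis.
  (* [g 0] is free of y, so the invariant already holds at index 1. *)
  - have i00 : i = 0%N by lia.
    by apply/eqP; rewrite i00 -leqn0; apply: lmon_size; rewrite size_I2_gen.
  - by rewrite size_I2_gen ltnS leq_maxl.
  - exact: wdeg_I2_gen.
have szg i : (i <= l)%N -> (size (g i) <= l.+1)%N by rewrite size_I2_gen.
have [t [st [run lab min cost]]] := @run_I3 F n k m l alpha v _ w l g 0 h 0 0 0 0
  (I1_cost alpha v + I2_cost m alpha h)%N (add0n l) inv_g.
exists st; split=> //.
  (* The two extra steps are I1 and I2. *)
  by split=> //; exists (t + 2)%N; rewrite iterD -run /= add0n.
have := @total_cost_bound n k m l w (st_count st) kn m1 ml _ kl3 _.
have -> : n%:R ^+ 4 * k%:R ^- 2 * m%:R ^+ 5 = (n ^ 4 * m ^ 5)%:R / (k ^ 2)%:R :> R.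
  by rewrite natrM !natrX; field; rewrite pnatr_eq0; lia.
move=> total; rewrite mulrA ler_pdivlMr; last by rewrite ltr0n expn_gt0; lia.
rewrite mulrC -!natrM ler_nat; apply: total; first by rewrite /w; lia.
apply: leq_trans cost _; apply: leq_add.
  by apply: leq_add; [exact: I1_cost_le | exact: I2_cost_le un].
by rewrite leq_mul2l (potential_bound inv_g) ?orbT.
Qed.
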